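(* Let $t \ge 4$ be a rational number, let $G$ be a $t$-tough graph on $n \ge 3$ vertices, and let $x, y \in V(G)$ be distinct non-adjacent vertices with $\deg(x) + \deg(y) \ge n - t$. Then $G$ is Hamiltonian if and only if $G + xy$ is Hamiltonian.
   Context: Graphs are simple, undirected and finite. Let $c(H)$ denote the number of components of a graph $H$. For a real number $t \ge 0$, $G$ is $t$-tough if $|S| \ge t \cdot c(G-S)$ for all $S \subseteq V(G)$ with $c(G-S) \ge 2$ (so complete graphs are $t$-tough for every $t$). For non-adjacent vertices $x, y$, $G+xy$ is the graph obtained from $G$ by adding the edge $xy$. Degrees $\deg(x),\deg(y)$ are taken in $G$. A graph is Hamiltonian if it has a cycle containing all its vertices. *)

(* Defs.v *)
From mathcomp Require Import all_boot all_order all_algebra.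
Set Implicit Arguments.
Unset Strict Implicit.
Unset Printing Implicit Defensive.
Import Order.TTheory GRing.Theory Num.Theory.

(* A graph with vertex type T : finType is a symmetric, irreflexive e : rel T;
   these two properties are hypotheses wherever they are used. *)

Definition deg (T : finType) (e : rel T) (v : T) : nat := #|[set w | e v w]|.

Definition add_edge (T : finType) (e : rel T) (x y : T) : rel T :=
  [rel u v | [|| e u v, (u == x) && (v == y) | (u == y) && (v == x)]].

Definition del_vertices (T : finType) (e : rel T) (S : {set T}) : rel T :=
  [rel u v | [&& u \notin S, v \notin S & e u v]].

(* c(G - S). The relation del_vertices e S lives on all of T, where every
   vertex of S is isolated, so roots are only counted outside S.  The count is
   the number of components because ~: S is closed under del_vertices e S and
   connect (del_vertices e S) is an equivalence relation for symmetric e. *)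
Definition ncomp_del (T : finType) (e : rel T) (S : {set T}) : nat :=
  n_comp (del_vertices e S) (~: S).

Definition tough (R : realFieldType) (T : finType) (t : R) (e : rel T) : Prop :=
  forall S : {set T}, (2 <= ncomp_del e S)%N ->
    (t * (ncomp_del e S)%:R <= #|S|%:R)%R.

(* ucycle alone accepts the empty sequence and [:: u; v] for an edge uv, which
   are not cycles of a simple graph; hence the bound on the size. *)
Definition hamiltonian (T : finType) (e : rel T) : Prop :=
  exists c : seq T, [/\ ucycle e c, (3 <= size c)%N & forall v : T, v \in c].

Lemma del_vertices_connect_sym (T : finType) (e : rel T) (S : {set T}) :
  symmetric e -> connect_sym (del_vertices e S).
Proof.
move=> e_sym; apply: sym_connect_sym => u v.
by rewrite /del_vertices /= (e_sym u v) andbCA.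
Qed.

Lemma del_vertices_closed (T : finType) (e : rel T) (S : {set T}) :
  closed (del_vertices e S) (~: S).
Proof. by move=> u v /and3P[uS vS _]; rewrite !inE uS vS. Qed.

(* Main.v *)
Require Import Defs.
From mathcomp Require Import all_boot all_order all_algebra.
From mathcomp Require Import zify lra.
Set Implicit Arguments.
Unset Strict Implicit.
Unset Printing Implicit Defensive.
Import Order.TTheory GRing.Theory Num.Theory.

(* If G + xy is Hamiltonian and G is not, there is a Hamiltonian path
   v_0 = x, ..., v_m = y.  Mark position j by X if x ~ v_{j+1}, by Y if
   y ~ v_j, by O otherwise; X and Y never coincide, so the degree condition
   leaves q <= t - 1 positions O.  Exchanging edges along the path shows that
   the vertices inside runs of X's and those inside runs of Y's are not
   adjacent, up to the boundaries of the runs.  Deleting everything else must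
   contradict toughness, and the cost is concentrated where a run of Y's is
   followed by a run of X's.
   - Directly (YX, a gap k): v_k has all its neighbours among the deleted
     vertices, so each gap is a further component.  Charging the neighbours of
     v_k to gaps and O's gives 2t <= deg v_k <= p + q + 1, so the number p of
     gaps is at least t.
   - With one O in between (YOX, a block): of the two vertices missed by the
     cycle x .. v_{i-1} y .. v_{i+2} x, one has no neighbour on its own side,
     since otherwise both could be inserted; this gives one further component.
   Without gaps and blocks at most 2q + 1 < 2t vertices are deleted, and without
   gaps but with a block at most 3q + 2 < 3t.  With p >= t gaps the number of
   deleted vertices is at most 3p + 3q + 1 without blocks, where there are p + 2
   components, and 3p + 5q with blocks, where there are p + 3; this is where
   t >= 4 enters. *)

(** * Counting the positions [0 .. m] with a given property *)

Section CountInitial.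
Variable m : nat.

(* Locked to keep [natrD] from splitting a count into its first term and the
   rest. *)
Definition cnt (P : pred nat) : nat := locked (count P (iota 0 m.+1)).

Lemma cnt_inj (f : nat -> nat) (P Q : pred nat) :
  (forall i j, i <= m -> j <= m -> P i -> P j -> f i = f j -> i = j) ->
  (forall i, i <= m -> P i -> f i <= m /\ Q (f i)) -> cnt P <= cnt Q.
Proof.
move=> f_inj PQ; rewrite /cnt -!lock -!size_filter -(size_map f).
have memP i : i \in filter P (iota 0 m.+1) -> i <= m /\ P i.
  by rewrite mem_filter mem_iota add0n leq0n /= => /andP[].
apply: uniq_leq_size.
  rewrite map_inj_in_uniq ?filter_uniq ?iota_uniq //.
  by move=> i j /memP[im Pi] /memP[jm Pj]; apply: f_inj.
move=> _ /mapP[i /memP[im Pi] ->]; have [fim Qfi] := PQ _ im Pi.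
by rewrite mem_filter mem_iota Qfi.
Qed.

Lemma cnt_cover (P Q R : pred nat) :
  (forall i, i <= m -> P i -> Q i || R i) -> cnt P <= cnt Q + cnt R.
Proof.
move=> PQR; apply: leq_trans (_ : cnt [predU Q & R] <= _).
  by apply: (@cnt_inj id) => // i im /(PQR _ im).
by rewrite /cnt -!lock -count_predUI leq_addr.
Qed.

(** Booleans are added as numbers, so one equation says that [P] and [Q] are disjoint with union
    [R]. *)
Lemma cnt_add (P Q R : pred nat) :
  (forall i, i <= m -> (P i + Q i)%N = R i) -> cnt P + cnt Q = cnt R.
Proof.
rewrite /cnt -!lock => PQR.
have: {in iota 0 m.+1, forall i, (P i + Q i)%N = R i}.
  by move=> i; rewrite mem_iota add0n => /PQR.
elim: (iota 0 m.+1) => //= i s IH sPQR.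
rewrite -sPQR ?mem_head // -IH; first by lia.
by move=> j js; apply: sPQR; rewrite inE js orbT.
Qed.

Lemma cnt0 (P : pred nat) : (forall i, i <= m -> ~~ P i) -> cnt P = 0.
Proof.
move=> P0; apply/eqP; rewrite /cnt -lock eqn0Ngt -has_count; apply/hasP => -[i].
by rewrite mem_iota add0n => /P0/negP.
Qed.

Lemma cnt1 k : k <= m -> cnt (pred1 k) = 1.
Proof. by move=> km; rewrite /cnt -!lock count_uniq_mem ?iota_uniq // mem_iota ltnS km. Qed.

Lemma cntT : cnt predT = m.+1.
Proof. by rewrite /cnt -!lock count_predT size_iota. Qed.

Lemma cnt_ltn : cnt (fun j => j < m) = m.
Proof.
rewrite /cnt -!lock -[m.+1]addn1 iotaD count_cat /= add0n ltnn (eq_in_count (a2 := predT)).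
  by rewrite count_predT size_iota !addn0.
by move=> j; rewrite mem_iota add0n => /andP[_ ->].
Qed.

End CountInitial.


(** * Cycles assembled from runs of consecutive integers *)

(* A monotone run through the integers between [a] and [b], in either
   direction; a cycle is built below as a closed chain of such runs. *)
Definition seg (a b : nat) : seq nat :=
  if a <= b then iota a (b - a).+1 else rev (iota b (a - b).+1).

Lemma size_seg a b : size (seg a b) = (maxn a b - minn a b).+1.
Proof. by rewrite /seg; case: ifP => ab; rewrite ?size_rev size_iota; lia. Qed.

Lemma mem_seg a b j : (j \in seg a b) = (minn a b <= j <= maxn a b).
Proof. by rewrite /seg; case: ifP => ab; rewrite ?mem_rev mem_iota; lia. Qed.

(** Each pair names a run; only the junctions are tested, [z] being the end of the preceding run. *)
Fixpoint linked (E : rel nat) (z : nat) (l : seq (nat * nat)) : bool :=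
  if l is s :: l' then E z s.1 && linked E s.2 l' else true.

Section Segments.
Variables (m : nat) (E : rel nat).
Hypothesis E_sym : symmetric E.
Hypothesis E_path : forall j, j < m -> E j j.+1.

Lemma iota_path a d : a + d <= m -> path E a (iota a.+1 d).
Proof.
elim: d a => //= d IH a adm; rewrite E_path; last by lia.
by apply: IH; lia.
Qed.

Lemma last_iota a d : last a (iota a.+1 d) = a + d.
Proof. by elim: d a => /= [|d IH] a; rewrite ?addn0 // IH addSnnS. Qed.

Lemma segE a b : a <= m -> b <= m ->
  exists s, [/\ seg a b = a :: s, path E a s & last a s = b].
Proof.
move=> am bm; rewrite /seg; case: ifP => ab.
  exists (iota a.+1 (b - a)); split=> //; first by apply: iota_path; lia.
  by rewrite last_iota; lia.
have blast : last b (iota b.+1 (a - b)) = a by rewrite last_iota; lia.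
exists (rev (belast b (iota b.+1 (a - b)))); split.
- by have := lastI b (iota b.+1 (a - b)); rewrite blast -rev_rcons => <-.
- rewrite -{1}blast rev_path (eq_path (e' := E)); first by apply: iota_path; lia.
  by move=> u v /=; rewrite E_sym.
case: (a - b) blast => //= d _; by rewrite rev_cons last_rcons.
Qed.

Lemma linked_path z l : all (fun s => (s.1 <= m) && (s.2 <= m)) l ->
  linked E z l -> path E z (flatten [seq seg s.1 s.2 | s <- l]).
Proof.
elim: l z => //= -[a b] l IH z /andP[/andP[/= am bm] lm] /andP[Eza bl].
have [s [-> sP slast]] := segE am bm.
by rewrite /= Eza cat_path sP slast IH.
Qed.

Hypothesis noham : forall c, perm_eq c (iota 0 m.+1) -> ~ cycle E c.

(** A list of [m.+1] entries that covers [0 .. m] has no repetition, so length and coverage, both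
    arithmetic, suffice. The final run [(a, a)] stands for the return to the start. *)
Lemma no_linked_cycle a b l :
  all (fun s => (s.1 <= m) && (s.2 <= m)) ((a, b) :: l) ->
  sumn [seq (maxn s.1 s.2 - minn s.1 s.2).+1 | s <- (a, b) :: l] = m.+1 ->
  (forall j, j <= m ->
    has (fun s => minn s.1 s.2 <= j <= maxn s.1 s.2) ((a, b) :: l)) ->
  ~ linked E b (rcons l (a, a)).
Proof.
move=> lm lsz lmem lnk.
pose c := flatten [seq seg s.1 s.2 | s <- (a, b) :: l].
have csz : size c = m.+1.
  rewrite size_flatten /shape -map_comp -lsz; congr sumn.
  by apply: eq_map => s /=; rewrite size_seg.
have sub : {subset iota 0 m.+1 <= c}.
  move=> j; rewrite mem_iota add0n => /lmem/hasP[s sl sj].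
  by apply/flatten_mapP; exists s; rewrite // mem_seg.
have csz' : size c <= size (iota 0 m.+1) by rewrite csz size_iota.
have [_ ceqi] := uniq_min_size (iota_uniq 0 m.+1) sub csz'.
have cuniq := leq_size_uniq (iota_uniq 0 m.+1) sub csz'.
apply: (@noham c); first by rewrite perm_sym uniq_perm ?iota_uniq.
move: (lm) => /= /andP[/andP[am bm] lm'].
rewrite /c /=; have [s [-> sP slast]] := segE am bm.
rewrite /= rcons_cat cat_path sP slast.
have -> : rcons (flatten [seq seg s.1 s.2 | s <- l]) a =
          flatten [seq seg s.1 s.2 | s <- rcons l (a, a)].
  by rewrite map_rcons flatten_rcons -cats1 /seg leqnn subnn.
by apply: linked_path => //; rewrite all_rcons /= am lm'.
Qed.

End Segments.

(** * Edge exchanges that would close a Hamiltonian cycle *)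

Section Crossings.
Variables (m : nat) (E : rel nat).
Hypothesis E_sym : symmetric E.
Hypothesis E_irr : irreflexive E.
Hypothesis E_path : forall j, j < m -> E j j.+1.
Hypothesis noham : forall c, perm_eq c (iota 0 m.+1) -> ~ cycle E c.

Ltac drop_edges := clear E_path noham;
  repeat match goal with H : is_true (E _ _) |- _ => clear H end.
Ltac ham a b l :=
  apply: (no_linked_cycle E_sym E_path noham (a := a) (b := b) (l := l)) => /=;
  [ drop_edges; lia | drop_edges; lia | move=> ? ?; drop_edges; lia
  | rewrite ?andbT; repeat (apply/andP; split); solve [done | by rewrite E_sym | by apply: E_path; lia | by rewrite E_sym; apply: E_path; lia] ].

Lemma no_end_swap j : j < m -> E 0 j.+1 -> E m j -> False.
Proof. by move=> jm xj yj; ham 0 j [:: (m, j.+1)]. Qed.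

Lemma no_cross_inner a c : a < c < m ->
  E a c.+1 -> E 0 a.+1 -> E m c -> False.
Proof. by move=> acm ac xa yc; ham 0 a [:: (c.+1, m); (c, a.+1)]. Qed.

Lemma no_cross_right a b : a < b < m ->
  E a b -> E m a.+1 -> E 0 b.+1 -> False.
Proof. by move=> abm ab ya xb; ham 0 a [:: (b, a.+1); (m, b.+1)]. Qed.

Lemma no_cross_left a b : a < b < m ->
  E a.+1 b.+1 -> E m a -> E 0 b -> False.
Proof. by move=> abm ab ya xb; ham 0 a [:: (m, b.+1); (a.+1, b)]. Qed.

(** The cycle 0 .. k m .. k+2 0 misses only [k.+1], which is inserted between two consecutive
    neighbours. *)
Lemma no_insert_right k b : k < b < m -> E m k -> E 0 k.+2 ->
  E k.+1 b.+1 -> E k.+1 b.+2 -> b.+2 <= m -> False.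
Proof.
move=> kbm yk xk kb kb' bm.
by ham 0 k [:: (m, b.+2); (k.+1, k.+1); (b.+1, k.+2)].
Qed.

Lemma no_insert_left k a : a < k -> k.+2 <= m -> E m k -> E 0 k.+2 ->
  E k.+1 a -> E k.+1 a.+1 -> False.
Proof.
move=> ak km yk xk ka ka'.
by ham 0 a [:: (k.+1, k.+1); (a.+1, k); (m, k.+2)].
Qed.

(** The cycle 0 .. i m .. i+3 0 misses [i.+1] and [i.+2]. The lemma names tell the side of [b], a
    neighbour of [i.+2], then that of [c], a neighbour of [i.+1]. *)
Section Block.
Variables i b c : nat.
Hypotheses (im : i.+3 <= m) (yi : E m i) (xi : E 0 i.+3).
Hypotheses (ub : E i.+2 b) (wc : E i.+1 c).

Lemma block_left_right : b < i -> i.+3 < c <= m -> E 0 b.+1 -> E m c.-1 -> False.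
Proof.
move=> bi icm xb yc.
by ham b 0 [:: (b.+1, i); (i.+1, i.+1); (c, m); (c.-1, i.+3); (i.+2, i.+2)].
Qed.

Lemma block_right_left : i.+3 < b < m -> c < i -> E 0 b.-1 -> E m c.+1 -> False.
Proof.
move=> ibm ci xb yc.
by ham 0 c [:: (i.+1, i.+1); (i, c.+1); (m, b); (i.+2, i.+2); (i.+3, b.-1)].
Qed.

Lemma block_left_left : b < i -> c < i -> b != c -> 0 < c ->
  E 0 b.+1 -> E m c.-1 -> E m c.+1 -> False.
Proof.
move=> bi ci bc c0 xb yc yc'; case: (ltngtP b c) => [bltc|cltb|]; last by lia.
  by ham b 0 [:: (b.+1, c); (i.+1, i.+1); (i, c.+1); (m, i.+3); (i.+2, i.+2)].
by ham b c [:: (i.+1, i.+1); (i, b.+1); (0, c.-1); (m, i.+3); (i.+2, i.+2)].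
Qed.

Lemma block_right_right : i.+3 < b < m -> i.+3 < c <= m -> b != c ->
  E 0 b.-1 -> E 0 b.+1 -> E m c.-1 -> False.
Proof.
move=> ibm icm bc xb xb' yc; case: (ltngtP b c) => [bltc|cltb|]; last by lia.
  by ham 0 i [:: (i.+1, i.+1); (c, m); (c.-1, b); (i.+2, i.+2); (i.+3, b.-1)].
by ham c b [:: (i.+2, i.+2); (i.+3, c.-1); (m, b.+1); (0, i); (i.+1, i.+1)].
Qed.

End Block.
End Crossings.

(** * Letters on the path and the nonadjacencies they force *)

Section Letters.
Variables (m : nat) (E : rel nat).
Hypothesis E_sym : symmetric E.
Hypothesis E_irr : irreflexive E.
Hypothesis E_path : forall j, j < m -> E j j.+1.
Hypothesis noham : forall c, perm_eq c (iota 0 m.+1) -> ~ cycle E c.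

(* Position [j < m] of the path carries the letter X if [0] is adjacent to
   [j.+1], the letter Y if [m] is adjacent to [j], and O otherwise; X and Y
   exclude each other, and at most [t - 1] positions carry O. *)
Definition lX j := (j < m) && E 0 j.+1.
Definition lY j := (j < m) && E m j.
Definition lO j := [&& j < m, ~~ lX j & ~~ lY j].
Definition after_lY c := (0 < c) && lY c.-1.
Definition lgap k := lX k && after_lY k.
Definition lblock i := [&& after_lY i, lO i & lX i.+1].
(* The sides of [0] and of [m] around [i].  A vertex [b] with letter X and a
   later vertex [c] just after a Y are never adjacent; for [c < b] this also
   needs a Y at [c.+1] or an X at [b.-2], and the restriction is put on [c]
   up to [i] and on [b] beyond [i].  Letters off the path count as X on the
   left and as Y on the right. *)
Definition lpartX i b := lX b && [|| b <= i, b <= 1 | lX b.-2].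
Definition lpartY i c := after_lY c && [|| i < c, m <= c.+1 | lY c.+1].

Lemma lXY j : lX j -> lY j -> False.
Proof. by move=> /andP[jm xj] /andP[_ yj]; apply: (no_end_swap E_sym E_path noham jm). Qed.

Lemma lXO j : lX j -> lO j -> False.
Proof. by move=> xj /and3P[_ /negP]. Qed.

Lemma lYO j : lY j -> lO j -> False.
Proof. by move=> yj /and3P[_ _ /negP]. Qed.

Lemma letterP j : j < m -> [|| lX j, lY j | lO j].
Proof. by rewrite /lO => ->; case: (lX j); case: (lY j). Qed.

Lemma ltm_lX j : lX j -> j < m. Proof. by case/andP. Qed.
Lemma ltm_lY j : lY j -> j < m. Proof. by case/andP. Qed.

Lemma lX_pred2 b : 1 < b -> lX b.-2 -> E 0 b.-1.
Proof. by case: b => [|[|b]] //= _ /andP[]. Qed.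

(** The edge would close a Hamiltonian cycle with the chords from 0 to [b.+1] and from [m] to
    [c.-1]; for [c = b.+1] one position would carry both letters. *)
Lemma nadj_lt b c : b < c -> lX b -> after_lY c -> ~~ E b c.
Proof.
case: c => // c bc xb yc; apply/negP => bEc.
have {}yc : lY c by [].
have [eq_bc|neq_bc] := eqVneq b c; first by case: (@lXY c) => //; rewrite -eq_bc.
case/andP: xb yc => _ xb /andP[cm yc].
by apply: (no_cross_inner E_sym E_path noham _ bEc xb yc); lia.
Qed.

Lemma nadj_gt_next c b : c < b -> lX b -> (m <= c.+1) || lY c.+1 -> ~~ E c b.
Proof.
move=> cb /andP[bm xb]; case/orP=> [|/andP[_ yc]]; first by lia.
by apply/negP => bEc; apply: (no_cross_right E_sym E_path noham _ bEc yc xb); lia.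
Qed.

Lemma nadj_gt_prev c b : c < b <= m -> after_lY c -> (b <= 1) || lX b.-2 -> ~~ E c b.
Proof.
case: c => // c; case: b => [|[|b]] //= cb yc /andP[bm xb].
have {yc} /andP[cm yc] : lY c by [].
by apply/negP => cEb; apply: (no_cross_left E_sym E_path noham _ cEb yc xb); lia.
Qed.

(* Otherwise both vertices of the block could be inserted into the cycle that
   avoids exactly these two vertices. *)
Lemma block_dichotomy i : lblock i ->
  (forall b, b <= m -> lpartX i b -> ~~ E i.+1 b) \/
  (forall c, c <= m -> lpartY i c -> ~~ E i c).
Proof.
(* From here on Y, O, X stand at [i], [i.+1], [i.+2]. *)
case: i => // i /and3P[yi oi xi].
have [/hasP[b]|] := boolP (has (fun b => lpartX i.+1 b && E i.+2 b) (iota 0 m.+1)); last first.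
  move/hasPn=> nE; left=> b bm xb; have := nE b.
  by rewrite mem_iota add0n ltnS bm xb /= => ->.
rewrite mem_iota add0n ltnS leq0n /= => bm /andP[/andP[xb hb] ub].
right=> c cm /andP[yc hc]; apply/negP => wc.
have {}yi : lY i by [].
have ltbE : b <= i.+1 -> b < i.
  move=> bi; have [e|] := eqVneq b i.+1; first by move: xb; rewrite e => /(@lXO i.+1)/(_ oi).
  have [e|] := eqVneq b i; first by move: xb; rewrite e => /(@lXY i)/(_ yi).
  by lia.
have gtb : i.+1 < b -> i.+3 < b /\ lX b.-2.
  move=> bi; have xb2 : lX b.-2 by case/or3P: hb => //; lia.
  split=> //; have [e|] := eqVneq b i.+2; first by move: xb2; rewrite e => /(@lXY i)/(_ yi).
  have [e|] := eqVneq b i.+3; first by move: xb2; rewrite e => /(@lXO i.+1)/(_ oi).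
  by lia.
have {}yc : 0 < c /\ lY c.-1 by apply/andP.
case: yc => c0 yc.
have gtc : i.+1 < c -> i.+3 < c.
  move=> ci; have [e|] := eqVneq c i.+2; first by move: yc; rewrite e => /(@lYO i.+1)/(_ oi).
  have [e|] := eqVneq c i.+3; first by move: yc; rewrite e => /((@lXY i.+2) xi).
  by lia.
have i2m := ltm_lX xi.
have ltc : c <= i.+1 -> c < i /\ lY c.+1.
  move=> ci; have yc2 : lY c.+1 by case/or3P: hc => //; lia.
  split=> //; have [e|] := eqVneq c i.+1; first by move: yc2; rewrite e => /((@lXY i.+2) xi).
  have [e|] := eqVneq c i; first by move: yc2; rewrite e => /(@lYO i.+1)/(_ oi).
  by lia.
(* A common neighbour would join an X to a later vertex just after a Y. *)
have bc : b != c.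
  apply/eqP => e; case: (leqP b i.+1) => [/ltbE bi|bi].
    have b_lt : b < i.+1 by lia.
    by have := nadj_lt b_lt xb yi; rewrite E_sym e wc.
  have yb : after_lY b by rewrite e /after_lY c0.
  by have [/ltnW b_gt _] := gtb bi; have := nadj_lt b_gt xi yb; rewrite ub.
have [b_lt_m Exb] : b < m /\ E 0 b.+1 by case/andP: xb.
have Eyi : E m i by case/andP: yi.
have Exi : E 0 i.+3 by case/andP: xi.
have Eyc : E m c.-1 by case/andP: yc.
case: (leqP b i.+1) => [/ltbE bi|/gtb[bi xb2]]; case: (leqP c i.+1) => [/ltc[ci yc2]|/gtc ci].
- have Eyc2 : E m c.+1 by case/andP: yc2.
  by apply: (block_left_left E_sym E_path noham (i := i) (b := b) (c := c)).
- by apply: (block_left_right E_sym E_path noham (i := i) (b := b) (c := c)); rewrite ?ci.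
- have Eyc2 : E m c.+1 by case/andP: yc2.
  have Exb2 : E 0 b.-1 by apply: lX_pred2; rewrite // (leq_trans _ bi).
  by apply: (block_right_left E_sym E_path noham (i := i) (b := b) (c := c)); rewrite ?bi.
- have Exb2 : E 0 b.-1 by apply: lX_pred2; rewrite // (leq_trans _ bi).
  by apply: (block_right_right E_sym E_path noham (i := i) (b := b) (c := c)); rewrite ?bi ?ci.
Qed.

Lemma cnt_letters : cnt m lX + cnt m lY + cnt m lO = m.
Proof.
have -> : cnt m lX + cnt m lY = cnt m (predU lX lY).
  apply: cnt_add => j _ /=; have := @lXY j.
  by case: (lX j); case: (lY j) => //= h; case: h.
rewrite (@cnt_add m _ _ (fun j => j < m)) => [|j _ /=]; last first.
  by rewrite /lO /lX /lY; case: (j < m); case: (E 0 _); case: (E m _).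
exact: cnt_ltn.
Qed.

Lemma cnt_row0 : cnt m (E 0) <= cnt m lX.
Proof.
apply: (@cnt_inj _ predn) => [[|i] [|j] _ _|[|i] im]; rewrite ?E_irr //=.
- by move=> _ _ ->.
- by move=> Ei; split; [lia | rewrite /lX im].
Qed.

Lemma cnt_rowm : cnt m (E m) <= cnt m lY.
Proof.
apply: (@cnt_inj _ id) => // i im Ei; split=> //.
by rewrite /lY Ei andbT ltn_neqAle im andbT; apply: contraTneq Ei => ->; rewrite E_irr.
Qed.

Lemma cnt_afterY : cnt m lY <= cnt m after_lY.
Proof. by apply: (@cnt_inj _ succn) => [i j _ _ _ _ []|i _ /= yi]; rewrite // ?(ltm_lY yi). Qed.

(** Charges from the left are at most [k], those from the right exceed [k]; so distinct positions
    with equal charges lie on the same side and are consecutive. *)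
Lemma charge_inj k (P : pred nat) (f : nat -> nat) :
  (forall b, P b -> (b < k) && (b <= f b <= b.+1) || (k.+2 < b) && (b.-2 <= f b <= b.-1)) ->
  (forall b, b < m -> P b -> ~~ P b.+1) ->
  forall i j, i <= m -> j <= m -> P i -> P j -> f i = f j -> i = j.
Proof.
move=> fP consec.
have mono i j : i < j -> j <= m -> P i -> P j -> f i <> f j.
  move=> ij jm Pi Pj fij; have := consec i (leq_trans ij jm) Pi.
  have -> : i.+1 = j; last by rewrite Pj.
  by move: (fP _ Pi) (fP _ Pj); rewrite fij; move: ij; clear; lia.
move=> i j im jm Pi Pj fij; case: (ltngtP i j) => // ij; last by case: (mono j i).
by case: (mono i j).
Qed.

(* Each neighbour [b] of a gap [k] other than [k.-1] and [k.+1] is charged to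
   a gap or an [lO] position next to it; two neighbours sharing this charge
   would be consecutive, and [k] could be inserted between them. *)
Lemma deg_gap k : lgap k -> cnt m (E k) <= cnt m lgap + cnt m lO + 1.
Proof.
case: k => [|k] /andP[] // xk yk.
have {}yk : lY k by [].
have km := ltm_lX xk.
have Eyk : E m k by case/andP: yk.
have Exk : E 0 k.+2 by case/andP: xk.
have gk : lgap k.+1 by rewrite /lgap xk.
pose P b := [&& E k.+1 b, b != k & b != k.+2].
(* The gap itself is left out, so its two path neighbours bring the bound to 2 + (p - 1) + q for p
   gaps and q letters O. *)
pose Q b := lgap b && (b != k.+1) || lO b.
(* On the left, [b] is not X and [b.+1] not Y: unless [b] is O it is Y, and [b.+1] is O or a gap. On
   the right, [b.-2] is not X and [b.-1] not Y: unless [b.-1] is O or a gap, it is X and [b.-2] is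
   O. *)
pose f b := if k < b then (if lO b.-1 || lgap b.-1 then b.-1 else b.-2)
            else (if lO b then b else b.+1).
have EP : cnt m (E k.+1) <= 1 + (1 + cnt m P).
  rewrite -[X in X + (_ + _)](@cnt1 m k) ?(ltnW (ltnW km)) //.
  rewrite -[X in _ + (X + _)](@cnt1 m k.+2) //.
  apply: leq_trans (@cnt_cover m _ (pred1 k) (predU (pred1 k.+2) P) _) _.
    by move=> b _ Eb; rewrite /= /P Eb; case: (b == k); case: (b == k.+2).
  by rewrite leq_add2l; apply: cnt_cover => b _ /= ->.
have PQ : cnt m P <= cnt m Q.
  have Pne b : P b -> (b < k) || (k.+2 < b).
    case/and3P=> Eb b1 b2; have b0 : b != k.+1 by apply: contraTneq Eb => ->; rewrite E_irr.
    by move: b0 b1 b2; clear; lia.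
  apply: (@cnt_inj _ f).
    apply: (@charge_inj k) => [b Pb|b bm Pb].
      by move: (Pne _ Pb); rewrite /f; case: ifP; case: ifP; clear; lia.
    apply/negP => Pb'; have /and3P[Eb _ _] := Pb; have /and3P[Eb' _ _] := Pb'.
    have [bk|kb] := boolP (b < k).
      exact: (no_insert_left E_sym E_path noham bk km Eyk Exk Eb Eb').
    move: (Pne _ Pb) kb Eb Eb' bm; case: b {Pb Pb'} => [|b] bk kb Eb Eb' bm.
      by move: kb bk; clear; lia.
    have kbm : k < b < m by move: kb bk bm; clear; lia.
    exact: (no_insert_right E_sym E_path noham kbm Eyk Exk Eb Eb' bm).
  move=> b bm Pb; have := Pne _ Pb; have /and3P[Eb _ _] := Pb.
  case/orP=> kb.
    have nX : ~~ lX b.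
      apply/negP=> xb; have := @nadj_lt b k.+1 (ltnW kb) xb yk.
      by rewrite E_sym Eb.
    have nY : ~~ lY b.+1.
      apply/negP=> yb; have := @nadj_gt_next b k.+1 (ltnW kb) xk.
      by rewrite yb orbT E_sym Eb => /(_ isT).
    rewrite /f ltnNge (ltnW kb) /=; case: ifP => ob; first by rewrite /Q ob orbT.
    have b_lt_m : b < m by move: kb km; clear; lia.
    have yb : lY b by have := letterP b_lt_m; rewrite ob (negPf nX) orbF.
    have b1_lt_m : b.+1 < m by move: kb km; clear; lia.
    split; first exact: ltnW.
    have := letterP b1_lt_m; rewrite /Q (negPf nY) /lgap /after_lY /= yb andbT.
    by case/orP => ->; rewrite ?orbT //; move: kb; clear; lia.
  have b1_lt_m : b.-1 < m by move: kb bm; clear; lia.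
  have b2_lt_m : b.-2 < m by move: kb bm; clear; lia.
  have nX : ~~ lX b.-2.
    apply/negP=> xb; have kbm : k.+1 < b <= m by rewrite bm; move: kb; clear; lia.
    by have := nadj_gt_prev kbm yk; rewrite xb orbT Eb => /(_ isT).
  have b_gt0 : 0 < b by move: kb; clear; lia.
  have nY : ~~ lY b.-1.
    apply/negP=> yb; have kb' : k.+1 < b by move: kb; clear; lia.
    have yb' : after_lY b by rewrite /after_lY b_gt0.
    by have := nadj_lt kb' xk yb'; rewrite Eb.
  rewrite /f (ltnW (ltnW kb)); case: ifP => ob.
    split; first exact: ltnW.
    rewrite /Q; case/orP: ob => ->; rewrite ?orbT //.
    by rewrite (_ : b.-1 != k.+1) //; move: kb; clear; lia.
  move/norP: ob => [ob gb]; split; first exact: ltnW.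
  have xb : lX b.-1 by have := letterP b1_lt_m; rewrite (negPf nY) (negPf ob) !orbF.
  have nY2 : ~~ lY b.-2.
    apply: contra gb => yb; rewrite /lgap xb /after_lY yb andbT.
    by move: kb; clear; lia.
  by have := letterP b2_lt_m; rewrite /Q (negPf nX) (negPf nY2) => /= ->; rewrite orbT.
have gapD : cnt m (fun b => lgap b && (b != k.+1)) + 1 = cnt m lgap.
  rewrite -(@cnt1 m k.+1) ?(ltnW km) //; apply: cnt_add => b _ /=.
  by have [->|] := eqVneq b k.+1; rewrite ?gk ?andbF ?andbT ?addn0.
have QO : cnt m Q <= cnt m (fun b => lgap b && (b != k.+1)) + cnt m lO.
  by apply: cnt_cover => b _.
by move: EP PQ gapD QO; clear; lia.
Qed.

End Letters.

(** * Separations of the path and the number of deleted vertices *)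

Section Counting.
Variables (m : nat) (E : rel nat) (t : rat).
Hypothesis E_sym : symmetric E.
Hypothesis E_irr : irreflexive E.
Hypothesis E_path : forall j, j < m -> E j j.+1.
Hypothesis noham : forall c, perm_eq c (iota 0 m.+1) -> ~ cycle E c.
Hypothesis m_gt0 : 0 < m.

Local Notation X := (lX m E).
Local Notation Y := (lY m E).
Local Notation O := (lO m E).
Local Notation afterY := (after_lY m E).
Local Notation gap := (lgap m E).
Local Notation block := (lblock m E).
Local Notation partX := (lpartX m E).
Local Notation partY := (lpartY m E).
Local Notation cnt := (cnt m).

Definition apart (P Q : pred nat) :=
  forall i j, i <= m -> j <= m -> P i -> Q j -> (i != j) && ~~ E i j.

Lemma apart_sub (P Q P' Q' : pred nat) :
  (forall i, i <= m -> P i -> P' i) -> (forall i, i <= m -> Q i -> Q' i) ->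
  apart P' Q' -> apart P Q.
Proof. by move=> PP QQ PQ i j im jm /(PP _ im) Pi /(QQ _ jm); apply: PQ. Qed.

Lemma apartU (P P' Q : pred nat) : apart P Q -> apart P' Q -> apart (predU P P') Q.
Proof. by move=> PQ PQ' i j im jm /orP[Pi|Pi]; [apply: PQ | apply: PQ']. Qed.

Lemma apart0 (Q : pred nat) : apart pred0 Q.
Proof. by []. Qed.

(** Toughness for the deletion of everything outside [A], [B], [W]: both sides and each vertex of
    [W] contribute a component. *)
Hypothesis tough_apart : forall A B W : pred nat,
  (exists2 a, a <= m & A a) -> (exists2 b, b <= m & B b) ->
  apart A B -> apart W A -> apart W B ->
  (forall i j, i <= m -> j <= m -> W i -> W j -> ~~ E i j) ->
  (t * (cnt W + 2)%:R + (cnt A + cnt B + cnt W)%:R <= m.+1%:R)%R.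
Hypothesis t_ge4 : (4%:R <= t)%R.
Hypothesis deg_ends : (m.+1%:R - t <= (cnt (E 0))%:R + (cnt (E m))%:R)%R.

Lemma nadj_ltC b c : b < c -> X b -> afterY c -> ~~ E c b.
Proof. by rewrite E_sym; apply: nadj_lt. Qed.

Lemma lX0 : X 0. Proof. by rewrite /lX m_gt0 E_path. Qed.

Lemma afterY_last : afterY m.
Proof.
have m1 : m.-1 < m by rewrite prednK.
by have := E_path m1; rewrite /after_lY m_gt0 /lY m1 prednK // E_sym.
Qed.

(** The letters X and Y number at least n - t, and only n - 1 positions carry a letter. *)
Lemma few_letters_O : ((cnt O)%:R + 1 <= t)%R.
Proof.
have := cnt_letters E_sym E_path noham; have := cnt_row0 m E_irr; have := cnt_rowm m E_irr.
move=> cy cx cxyo; have cO : cnt (E 0) + cnt (E m) + cnt O <= m by move: cx cy cxyo; clear; lia.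
move: cO; rewrite -(ler_nat rat) !natrD => cO.
have d := deg_ends; rewrite -[m.+1]addn1 natrD in d.
by move: cO d; lra.
Qed.

Lemma cnt_letters_after : m <= cnt X + cnt afterY + cnt O.
Proof.
by rewrite -{1}(cnt_letters E_sym E_path noham) leq_add2r leq_add2l cnt_afterY.
Qed.

Lemma apart_parts i : (forall k, k <= m -> ~~ gap k) -> apart (partX i) (partY i).
Proof.
move=> nogap b c bm cm /andP[xb hb] /andP[yc hc]; apply/andP; split.
  by apply: contra (nogap _ cm) => /eqP e; rewrite /lgap yc -e xb.
have [bc|cb|e] := ltngtP b c; first exact: (nadj_lt E_sym E_path noham).
  rewrite E_sym; have [ic|ci] := boolP (i < c).
    apply: (nadj_gt_prev E_sym E_path noham) => //; first by rewrite cb.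
    by move: hb; rewrite leqNgt (ltn_trans ic cb).
  by apply: (nadj_gt_next E_sym E_path noham) => //; move: hc; rewrite (negPf ci).
by rewrite e E_irr.
Qed.

Lemma partX0 i : partX i 0.
Proof. by rewrite /lpartX lX0. Qed.

Lemma partY_last i : partY i m.
Proof. by rewrite /lpartY afterY_last leqnSn orbT. Qed.

(** [r] is [i.+1] or [i], whichever [block_dichotomy] keeps off its own side; the X at [i.+1],
    respectively the Y just before [i], keeps it off the other side. *)
Lemma block_isolated i : block i -> exists r,
  [/\ r <= m, ~~ gap r, apart (pred1 r) (partX i) & apart (pred1 r) (partY i)].
Proof.
move=> blk; have /and3P[yi oi xi] := blk.
have i1m := ltm_lX xi.
have i_gt0 : 0 < i by case/andP: yi.
have yi1 : Y i.-1 by case/andP: yi.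
have XO := lXO; have XY := lXY E_sym E_path noham; have YO := lYO.
case: (block_dichotomy E_sym E_path noham blk) => [ux|wy].
  exists i.+1; split; first exact: ltnW.
  - by apply/negP => /andP[_ /andP[_ /= yi']]; apply: (YO _ _ _ yi' oi).
  - move=> _ b _ bm /eqP-> xb; rewrite ux // andbT; apply: contraTneq xb => <-.
    rewrite /lpartX xi ltnn /= -[i.+1 <= 1]/(i <= 0) leqNgt i_gt0 /=.
    by apply/negP => /XY/(_ yi1).
  move=> _ c _ cm /eqP-> /andP[yc hc]; have [ic|ci|e] := ltngtP i.+1 c.
  - exact: (nadj_lt E_sym E_path noham).
  - rewrite E_sym; apply: (nadj_gt_next E_sym E_path noham) => //.
    by move: hc; rewrite ltnNge -ltnS ci.
  - by case/andP: yc; rewrite -e => _ /= yc; case: (YO _ _ _ yc oi).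
exists i; split; first exact: (ltnW (ltnW i1m)).
- by apply/negP => /andP[xi' _]; apply: (XO _ _ _ xi' oi).
- move=> _ b _ bm /eqP-> /andP[xb hb]; have [ib|bi|e] := ltngtP i b.
  + apply: (nadj_gt_prev E_sym E_path noham) => //; first by rewrite ib.
    by move: hb; rewrite leqNgt ib.
  + exact: nadj_ltC.
  + by case: (XO _ _ _ xb); rewrite -e.
move=> _ c _ cm /eqP-> yc; rewrite wy // andbT; apply: contraTneq yc => <-.
rewrite /lpartY yi ltnn leqNgt i1m /=; apply/negP => yi2; exact: (XY _ xi yi2).
Qed.

Lemma ge_block i : block i -> 0 < i < m.
Proof. by case/and3P=> /andP[-> _] /and3P[-> _ _]. Qed.

(** An X beyond [i] is lost only if [b.-2] carries no X; without gaps, [b.-1] or [b.-2] is then O,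
    so each O from [i] on pays for at most two losses. *)
Lemma cnt_partX_block i : (forall k, k <= m -> ~~ gap k) -> block i ->
  cnt X <= cnt (partX i) + 2 * cnt (fun j => O j && (i <= j)).
Proof.
move=> nogap blk; have /and3P[yi oi xi] := blk.
have /andP[i_gt0 im] := ge_block blk.
pose L b := [&& X b, i < b & ~~ X b.-2].
pose L1 b := (1 < b) && (O b.-2 && (i <= b.-2)).
pose L2 b := (0 < b) && (O b.-1 && (i <= b.-1)).
have XL : cnt X <= cnt (partX i) + cnt L.
  apply: cnt_cover => b bm xb; rewrite /lpartX /L xb /= ltnNge.
  by case: (b <= i) => //=; case: (b <= 1) => //=; case: (X _).
have L12 : cnt L <= cnt L1 + cnt L2.
  apply: cnt_cover => b bm /and3P[xb ib nxb].
  have b_gt1 : 1 < b by apply: leq_trans ib.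
  have b1m : b.-1 < m by rewrite (leq_trans _ bm) // prednK // ltnW.
  have b2m : b.-2 < m by rewrite (leq_trans _ b1m) // ltnS leq_pred.
  have ib1 : i <= b.-1 by move: ib; clear; lia.
  have nyb : ~~ Y b.-1.
    by apply: contra (nogap b bm) => yb; rewrite /lgap xb /after_lY yb ltnW.
  rewrite /L1 /L2 b_gt1 (ltnW b_gt1) /=; have := letterP E b1m; rewrite (negPf nyb) /=.
  case/orP => [xb1|ob]; last by rewrite ob ib1 /= orbT.
  have nyb2 : ~~ Y b.-2.
    apply: contra (nogap b.-1 (ltnW b1m)) => yb; rewrite /lgap xb1 /after_lY yb andbT.
    by rewrite -ltnS prednK // ltnW.
  have := letterP E b2m; rewrite (negPf nxb) (negPf nyb2) /= => ob; rewrite ob /=.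
  (* [b.-2] could fall short of [i] only as [i.-1], which carries Y. *)
  apply/orP; left; have : i.-1 != b.-2.
    by apply: contraTneq ob => <-; apply/negP; apply: lYO; case/andP: yi.
  by move: ib i_gt0; clear; lia.
have L1q : cnt L1 <= cnt (fun j => O j && (i <= j)).
  apply: (@cnt_inj m (fun b => b.-2)) => [b c _ _ /andP[b1 _] /andP[c1 _]|b bm /andP[_ ->]].
    by move: b1 c1; clear; lia.
  by split=> //; move: bm; clear; lia.
have L2q : cnt L2 <= cnt (fun j => O j && (i <= j)).
  apply: (@cnt_inj m predn) => [b c _ _ /andP[b1 _] /andP[c1 _]|b bm /andP[_ ->]].
    by move: b1 c1; clear; lia.
  by split=> //; move: bm; clear; lia.
by move: XL L12 L1q L2q; clear; lia.
Qed.

Lemma cnt_partY_block i : (forall k, k <= m -> ~~ gap k) -> block i ->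
  cnt afterY <= cnt (partY i) + 2 * cnt (fun j => O j && (j <= i)).
Proof.
move=> nogap blk; have /and3P[yi oi xi] := blk.
have i1m := ltm_lX xi.
pose L c := [&& afterY c, c <= i & ~~ Y c.+1].
pose L1 c := O c.+1 && (c.+1 <= i).
pose L2 c := O c && (c <= i).
have YL : cnt afterY <= cnt (partY i) + cnt L.
  apply: cnt_cover => c cm yc; rewrite /lpartY /L yc /= (leqNgt c i).
  by case: (i < c) => //=; case: (m <= c.+1) => //=; case: (Y _).
have L12 : cnt L <= cnt L1 + cnt L2.
  apply: cnt_cover => c cm /and3P[yc ci nyc]; rewrite /L1 /L2 ci !andbT.
  have c1m : c.+1 < m by apply: leq_ltn_trans i1m; rewrite ltnS.
  have nxc : ~~ X c by apply: contra (nogap c cm) => xc; rewrite /lgap xc.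
  have := letterP E (ltnW c1m); rewrite (negPf nxc) /=.
  case/orP => [yc1|->]; last by rewrite orbT.
  have nxc1 : ~~ X c.+1 by apply: contra (nogap _ (ltnW c1m)) => xc; rewrite /lgap xc.
  have := letterP E c1m; rewrite (negPf nxc1) (negPf nyc) /= => oc; rewrite oc /=.
  have : c != i by apply: contraTneq yc1 => ->; apply/negP => /lYO/(_ oi).
  by rewrite neq_ltn => /orP[-> //|]; rewrite ltnNge ci.
have L1q : cnt L1 <= cnt (fun j => O j && (j <= i)).
  apply: (@cnt_inj m succn) => [b c _ _ _ _ []//|c _ Lc]; split=> //.
  by case/andP: Lc => /and3P[/ltnW].
by move: YL L12 L1q; rewrite /L2; clear; lia.
Qed.

Lemma no_gap_block i : (forall k, k <= m -> ~~ gap k) -> block i -> False.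
Proof.
move=> nogap blk; have [r [rm _ rX rY]] := block_isolated blk.
have im : i <= m by case/andP: (ge_block blk) => _ /ltnW.
have rr j k : j <= m -> k <= m -> pred1 r j -> pred1 r k -> ~~ E j k.
  by move=> _ _ /eqP-> /eqP->; rewrite E_irr.
have := tough_apart (ex_intro2 _ _ 0 (leq0n m) (partX0 i))
  (ex_intro2 _ _ m (leqnn m) (partY_last i)) (apart_parts nogap) rX rY rr.
rewrite cnt1 // => tgh.
(* The O of the block itself is counted on both sides. *)
have Oi : cnt (fun j => O j && (i <= j)) + cnt (fun j => O j && (j <= i)) <= cnt O + 1.
  have oi : O i by case/and3P: blk.
  have -> : cnt (fun j => O j && (j <= i)) = cnt (fun j => O j && (j < i)) + 1.
    rewrite -(cnt1 im); apply/esym/cnt_add => j _ /=; rewrite (leq_eqVlt j i).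
    by have [->|] := eqVneq j i; rewrite ?oi ?ltnn ?addn0.
  rewrite addnA leq_add2r (@cnt_add m _ _ O) // => j _ /=.
  by rewrite leqNgt; case: (O j); case: (j < i).
have hX := cnt_partX_block nogap blk; have hY := cnt_partY_block nogap blk.
have hL := cnt_letters_after; have q_lt_t := few_letters_O.
have : m.+1 <= cnt (partX i) + cnt (partY i) + cnt O * 3 + 3.
  by move: Oi hX hY hL; clear; lia.
rewrite -(ler_nat rat) !natrD natrM => hm.
by move: tgh hm q_lt_t; rewrite !natrD; lra.
Qed.

(** With threshold [m] the X side is complete. A vertex [c] lost on the Y side has O at [c.+1]: an X
    there would make [c.+1] a gap or [c] a block. *)
Lemma no_gap_no_block : (forall k, k <= m -> ~~ gap k) ->
  (forall i, i <= m -> ~~ block i) -> False.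
Proof.
move=> nogap noblock.
have := tough_apart (ex_intro2 _ _ 0 (leq0n m) (partX0 m))
  (ex_intro2 _ _ m (leqnn m) (partY_last m)) (apart_parts nogap)
  (@apart0 _) (@apart0 _) (fun _ _ _ _ f => False_ind _ (notF f)).
have -> : cnt pred0 = 0 by apply: cnt0.
move=> tgh; have q_lt_t := few_letters_O; have hL := cnt_letters_after.
have hX : cnt X <= cnt (partX m).
  by apply: (@cnt_inj m id) => // b bm xb; rewrite /lpartX xb bm.
have hY : cnt afterY <= cnt (partY m) + cnt O.
  pose L c := afterY c && O c.+1.
  have YL : cnt afterY <= cnt (partY m) + cnt L.
    apply: cnt_cover => c cm yc; rewrite /lpartY /L yc /= ltnNge cm /=.
    have [//|c1m] := leqP m c.+1.
    have nxc : ~~ X c by apply: contra (nogap c cm) => xc; rewrite /lgap xc.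
    have := letterP E c1m; have [xc1 _|nxc1] := boolP (X c.+1) => //=.
    have := letterP E (ltnW c1m); rewrite (negPf nxc) /= => /orP[yc1|oc].
      by have := nogap _ (ltnW c1m); rewrite /lgap xc1 /after_lY /= yc1.
    by have := noblock _ cm; rewrite /lblock yc oc xc1.
  apply: leq_trans YL _; rewrite leq_add2l.
  apply: (@cnt_inj m succn) => [b c _ _ _ _ []//|c _ /andP[_ oc]]; split=> //.
  by case/and3P: oc => /ltnW.
have : m.+1 <= cnt (partX m) + cnt (partY m) + cnt O * 2 + 1.
  by move: hX hY hL; clear; lia.
rewrite -(ler_nat rat) !natrD natrM => hm.
by move: tgh hm q_lt_t; rewrite !natrD; lra.
Qed.

(** Gaps may lie anywhere, so the restriction on [b.-2] is now imposed along the whole path; the X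
    at [b.-1] keeps gaps out of the core. [coreY] is the mirror image. *)
Definition coreX b := [&& X b, (b == 0) || X b.-1 & (b <= 1) || X b.-2].
Definition coreY c := [&& afterY c, (m <= c) || Y c & (m <= c.+1) || Y c.+1].

Lemma coreX_partX i b : coreX b -> partX i b.
Proof. by case/and3P=> xb _ h; rewrite /lpartX xb h orbT. Qed.

Lemma coreY_partY i c : coreY c -> partY i c.
Proof. by case/and3P=> yc _ h; rewrite /lpartY yc h orbT. Qed.

Lemma gap_coreX k : gap k -> ~~ coreX k.
Proof.
case/andP=> _ /andP[k0 yk]; apply/negP => /and3P[_ + _].
by rewrite eqn0Ngt k0 /= => /(lXY E_sym E_path noham); apply.
Qed.

Lemma gap_coreY k : gap k -> ~~ coreY k.
Proof.
case/andP=> xk _; apply/negP => /and3P[_ + _].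
by rewrite leqNgt (ltm_lX xk) /=; apply: (lXY E_sym E_path noham).
Qed.

Lemma apart_core : apart coreX coreY.
Proof.
move=> b c bm cm cb cc; apply/andP; split.
  apply/eqP => e; case/and3P: cb => xb _ _; case/and3P: cc => _ + _; rewrite -e.
  by rewrite leqNgt (ltm_lX xb) /=; apply: (lXY E_sym E_path noham).
case/and3P: cb => xb _ _; case/and3P: cc => yc _ hc; have [bc|cb|e] := ltngtP b c.
- exact: (nadj_lt E_sym E_path noham).
- by rewrite E_sym; apply: (nadj_gt_next E_sym E_path noham).
- by rewrite e E_irr.
Qed.

Lemma apart_gap_coreX : apart gap coreX.
Proof.
move=> k b km bm gk cb; apply/andP; split.
  by apply/eqP => e; have := gap_coreX gk; rewrite e cb.
case/andP: gk => xk yk; case/and3P: cb => xb _ hb; have [kb|bk|->] := ltngtP k b.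
- by apply: (nadj_gt_prev E_sym E_path noham); rewrite ?kb.
- exact: nadj_ltC.
- by rewrite E_irr.
Qed.

Lemma apart_gap_coreY : apart gap coreY.
Proof.
move=> k c km cm gk cc; apply/andP; split.
  by apply/eqP => e; have := gap_coreY gk; rewrite e cc.
case/andP: gk => xk yk; case/and3P: cc => yc _ hc; have [kc|ck|->] := ltngtP k c.
- exact: (nadj_lt E_sym E_path noham).
- by rewrite E_sym; apply: (nadj_gt_next E_sym E_path noham).
- by rewrite E_irr.
Qed.

Lemma gap_indep k l : k <= m -> l <= m -> gap k -> gap l -> ~~ E k l.
Proof.
move=> _ _ /andP[xk yk] /andP[xl yl]; have [kl|lk|->] := ltngtP k l.
- exact: (nadj_lt E_sym E_path noham).
- exact: nadj_ltC.
- by rewrite E_irr.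
Qed.

Lemma coreX0 : coreX 0. Proof. by rewrite /coreX lX0. Qed.

Lemma coreY_last : coreY m. Proof. by rewrite /coreY afterY_last leqnn leqnSn. Qed.

Definition startX b := [&& X b, 0 < b & O b.-1].
Definition endY c := afterY c && O c.

(** Of a run of X's not starting at 0, only the first two positions are lost, and such a run starts
    at a gap or after an O. *)
Lemma cnt_coreX : cnt X <= cnt coreX + 2 * (cnt gap + cnt startX).
Proof.
pose L1 b := [&& X b, 0 < b & ~~ X b.-1].
pose L2 b := (1 < b) && L1 b.-1.
have XL : cnt X <= cnt coreX + (cnt L1 + cnt L2).
  apply: leq_trans (@cnt_cover m _ coreX (predU L1 L2) _) _; last first.
    by rewrite leq_add2l; apply: cnt_cover.
  move=> b bm xb; rewrite /coreX /= /L2 /L1 xb /=.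
  case: b bm xb => [|[|b]] //= bm xb; first by case: (X 0).
  by case: (X b.+1) => //=; case: (X b).
have L1c : cnt L1 <= cnt gap + cnt startX.
  apply: cnt_cover => -[|b] bm /and3P[xb // _ nxb].
  have := letterP E (bm : b < m); rewrite /= in nxb *; rewrite (negPf nxb) /=.
  by rewrite /lgap /startX xb /after_lY.
have L2c : cnt L2 <= cnt L1.
  apply: (@cnt_inj m predn) => [b c _ _ /andP[b1 _] /andP[c1 _]|b bm /andP[_ L1b]].
    by move: b1 c1; clear; lia.
  by split=> //; apply: leq_trans (leq_pred b) bm.
by move: XL L1c L2c; clear; lia.
Qed.

Lemma cnt_coreY : cnt afterY <= cnt coreY + 2 * (cnt gap + cnt endY).
Proof.
pose L1 c := [&& afterY c, c < m & ~~ Y c].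
pose L2 c := L1 c.+1.
have YL : cnt afterY <= cnt coreY + (cnt L1 + cnt L2).
  apply: leq_trans (@cnt_cover m _ coreY (predU L1 L2) _) _; last first.
    by rewrite leq_add2l; apply: cnt_cover.
  move=> c cm yc; rewrite /coreY /= /L2 /L1 yc /=.
  have [mc|c_lt_m] /= := leqP m c; first by rewrite (leqW mc).
  rewrite /after_lY /=; case: (Y c) => //=.
  by case: leqP => //= _; case: (Y _).
have L1c : cnt L1 <= cnt gap + cnt endY.
  apply: cnt_cover => c cm /and3P[yc c_lt_m nyc].
  have := letterP E c_lt_m; rewrite (negPf nyc) /lgap /endY yc /=.
  by rewrite andbT.
have L2c : cnt L2 <= cnt L1.
  by apply: (@cnt_inj m succn) => [b c _ _ _ _ []//|c _ L1c']; split=> //; case/and3P: L1c' => _ /ltnW.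
by move: YL L1c L2c; clear; lia.
Qed.

Lemma cnt_startX : cnt startX <= cnt O.
Proof.
apply: (@cnt_inj m predn) => [[|b] [|c] _ _ /and3P[_ // _ _] /and3P[_ // _ _] /= -> //|b bm /and3P[_ _ ob]].
by split=> //; apply: leq_trans (leq_pred b) bm.
Qed.

Lemma cnt_endY : cnt endY <= cnt O.
Proof. by apply: (@cnt_inj m id) => // c cm /andP[]. Qed.

(** An O charged by both counts would be the O of a block. *)
Lemma cnt_startX_endY : (forall i, i <= m -> ~~ block i) -> cnt startX + cnt endY <= cnt O.
Proof.
move=> noblock; pose L j := O j && X j.+1.
have XL : cnt startX <= cnt L.
  apply: (@cnt_inj m predn) => [[|b] [|c] _ _ /and3P[_ // _ _] /and3P[_ // _ _] /= -> //|[|b] bm /and3P[xb // _ ob]].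
  by split; [apply: ltnW | rewrite /L xb andbT].
apply: leq_trans (_ : cnt L + cnt endY <= _); first by rewrite leq_add2r.
rewrite (@cnt_add m _ _ (predU L endY)) => [|j jm /=].
  by apply: (@cnt_inj m id) => // j jm /orP[] /andP[].
have := noblock j jm; rewrite /L /endY /lblock.
by case: (O j); case: (X j.+1); case: (afterY j).
Qed.

(** The neighbours of [k] separate it from 0: were 0 adjacent to [k], position [k.-1] would carry
    both X and Y. *)
Lemma deg_gap_tough k : k <= m -> gap k -> (2 * t <= (cnt (E k))%:R)%R.
Proof.
move=> km gk; pose B j := (j != k) && ~~ E k j.
have B0 : B 0.
  have /andP[xk /andP[k0 yk]] := gk; rewrite /B eq_sym -lt0n k0 E_sym /=.
  apply/negP => E0k; have k1 : X k.-1 by rewrite /lX prednK // E0k andbT (leq_trans _ km) // prednK.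
  exact: (lXY E_sym E_path noham k1 yk).
have kB : apart (pred1 k) B.
  by move=> _ j _ _ /eqP-> /andP[jk nE]; rewrite eq_sym jk.
have := @tough_apart (pred1 k) B pred0 (ex_intro2 _ _ k km (eqxx k)) (ex_intro2 _ _ 0 (leq0n m) B0) kB
  (@apart0 _) (@apart0 _) (fun _ _ _ _ f => False_ind _ (notF f)).
have -> : cnt pred0 = 0 by apply: cnt0.
rewrite cnt1 // => tgh.
have cE : cnt B + (cnt (E k) + 1) = m.+1.
  have -> : cnt (E k) + 1 = cnt (predU (E k) (pred1 k)).
    rewrite -(cnt1 km); apply: cnt_add => j _ /=.
    by have [->|] := eqVneq j k; rewrite ?E_irr ?orbF ?addn0.
  rewrite (@cnt_add m _ _ predT) => [|j _ /=]; last first.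
    by rewrite /B /=; case: (E k j); case: (j == k).
  exact: cntT.
move: cE => /(congr1 (fun n => n%:R : rat)%R); rewrite !natrD => cE.
by move: tgh; rewrite !natrD -cE; lra.
Qed.

Lemma many_gaps k : k <= m -> gap k -> (t <= (cnt gap)%:R)%R.
Proof.
move=> km gk; have := deg_gap E_sym E_irr E_path noham gk.
rewrite -(ler_nat rat) !natrD => h; have := deg_gap_tough km gk; have := few_letters_O.
by move: h; lra.
Qed.

Lemma gap_block k i : k <= m -> gap k -> block i -> False.
Proof.
move=> km gk blk; have [r [rm ngr rX rY]] := block_isolated blk.
pose W := predU gap (pred1 r).
have WX : apart W coreX.
  by apply: apartU apart_gap_coreX _; apply: apart_sub rX => // b _; apply: coreX_partX.
have WY : apart W coreY.
  by apply: apartU apart_gap_coreY _; apply: apart_sub rY => // c _; apply: coreY_partY.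
have rg l : l <= m -> gap l -> ~~ E r l.
  move=> lm /andP[xl yl]; have [li|il] := leqP l i.
    have pl : partX i l by rewrite /lpartX xl li.
    by case/andP: (rX r l rm lm (eqxx r) pl).
  have pl : partY i l by rewrite /lpartY yl il.
  by case/andP: (rY r l rm lm (eqxx r) pl).
have WW u v : u <= m -> v <= m -> W u -> W v -> ~~ E u v.
  move=> um vm /orP[gu|/eqP->] /orP[gv|/eqP->]; rewrite ?E_irr //.
  - exact: gap_indep.
  - by rewrite E_sym rg.
  - exact: rg.
have := tough_apart (ex_intro2 _ _ 0 (leq0n m) coreX0)
  (ex_intro2 _ _ m (leqnn m) coreY_last) apart_core WX WY WW.
have -> : cnt W = cnt gap + 1.
  rewrite -(cnt1 rm); apply/esym/cnt_add => j _ /=.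
  by have [->|] := eqVneq j r; rewrite ?(negPf ngr) ?orbF ?addn0.
move=> tgh; have hX := cnt_coreX; have hY := cnt_coreY.
have sX := cnt_startX; have eY := cnt_endY; have hL := cnt_letters_after.
have : m.+1 <= cnt coreX + cnt coreY + cnt gap * 4 + cnt O * 5 + 1.
  by move: hX hY sX eY hL; clear; lia.
rewrite -(ler_nat rat) !natrD !natrM => hm.
have hp := many_gaps km gk; have hq := few_letters_O.
(* With p gaps and q letters O, t(p + 3) <= 3p + 5q; as p >= t and q <= t - 1, this gives t(t - 3)
   <= 2t - 5, false for t >= 4. *)
by move: tgh; rewrite !natrD; move: hm hp hq t_ge4; nra.
Qed.

Lemma gap_no_block k : k <= m -> gap k -> (forall i, i <= m -> ~~ block i) -> False.
Proof.
move=> km gk noblock.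
have := tough_apart (ex_intro2 _ _ 0 (leq0n m) coreX0)
  (ex_intro2 _ _ m (leqnn m) coreY_last) apart_core apart_gap_coreX apart_gap_coreY gap_indep.
move=> tgh; have hX := cnt_coreX; have hY := cnt_coreY.
have se := cnt_startX_endY noblock; have hL := cnt_letters_after.
have : m.+1 <= cnt coreX + cnt coreY + cnt gap * 4 + cnt O * 3 + 1.
  by move: hX hY se hL; clear; lia.
rewrite -(ler_nat rat) !natrD !natrM => hm.
have hp := many_gaps km gk; have hq := few_letters_O.
(* Here t(p + 2) <= 3p + 3q + 1, which would give t(t - 3) <= t - 2. *)
by move: tgh; rewrite !natrD; move: hm hp hq t_ge4; nra.
Qed.

Lemma no_hamiltonian_path : False.
Proof.
have [/hasP[k]|/hasPn nogap] := boolP (has gap (iota 0 m.+1));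
  have [/hasP[i]|/hasPn noblock] := boolP (has block (iota 0 m.+1)).
- by move=> _ blk; rewrite mem_iota => km gk; apply: (gap_block km gk blk).
- rewrite mem_iota => km gk; apply: (gap_no_block km gk) => i im.
  by apply: noblock; rewrite mem_iota.
- by move=> _; apply: no_gap_block => k km; apply: nogap; rewrite mem_iota.
- apply: no_gap_no_block => k km; [apply: nogap | apply: noblock];
    by rewrite mem_iota.
Qed.

End Counting.

(** * Toughness applied to a separation *)

(** A map constant along the remaining edges is constant on components, so it takes at most as many
    values as there are components. *)
Lemma leq_ncomp_del (T T' : finType) (e : rel T) (S : {set T}) (f : T -> T') :
  symmetric e ->
  (forall u v, u \notin S -> v \notin S -> e u v -> f u = f v) ->
  #|f @: ~: S| <= ncomp_del e S.
Proof.
move=> e_sym fe; pose r := del_vertices e S.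
have f_connect u v : connect r u v -> f u = f v.
  case/connectP=> q; elim: q u => [u _ ->//|w q IH u /= /andP[/and3P[uS wS euw] qP] vE].
  by rewrite (fe _ _ uS wS euw); apply: IH.
apply: leq_trans (leq_imset_card f [predI roots r & ~: S]).
apply/subset_leq_card/subsetP => _ /imsetP[u uS ->].
apply/imsetP; exists (fingraph.root r u); last exact: f_connect (connect_root _ _).
apply/andP; split; first exact: roots_root (del_vertices_connect_sym S e_sym) _.
by rewrite -(closed_connect (@del_vertices_closed _ e S) (connect_root r u)).
Qed.

Lemma tough_separation (R : realFieldType) (T : finType) (t : R) (e : rel T)
    (A B W : {set T}) :
  symmetric e -> (0 <= t)%R -> tough t e -> A != set0 -> B != set0 ->
  (forall u v, u \in A -> v \in B -> (u != v) && ~~ e u v) ->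
  (forall u v, u \in W -> v \in A -> (u != v) && ~~ e u v) ->
  (forall u v, u \in W -> v \in B -> (u != v) && ~~ e u v) ->
  (forall u v, u \in W -> v \in W -> ~~ e u v) ->
  (t * (#|W| + 2)%:R <= #|~: (A :|: B :|: W)|%:R)%R.
Proof.
move=> e_sym t0 e_tough /set0Pn[a aA] /set0Pn[b bB] AB WA WB WW.
(* Collapsing [A] to [a] and [B] to [b] leaves |W| + 2 values; this lower bound on the components
   suffices since t >= 0. *)
set S := ~: _; pose f v := if v \in A then a else if v \in B then b else v.
have notAB v : v \in B -> v \notin A.
  by move=> vB; apply/negP => vA; have := AB v v vA vB; rewrite eqxx.
have notWA v : v \in W -> v \notin A.
  by move=> vW; apply/negP => vA; have := WA v v vW vA; rewrite eqxx.
have notWB v : v \in W -> v \notin B.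
  by move=> vW; apply/negP => vB; have := WB v v vW vB; rewrite eqxx.
have fe u v : u \notin S -> v \notin S -> e u v -> f u = f v.
  rewrite !inE !negbK -!orbA => /or3P[uA|uB|uW] /or3P[vA|vB|vW] euv.
  - by rewrite /f uA vA.
  - by have := AB u v uA vB; rewrite euv andbF.
  - by have := WA v u vW uA; rewrite e_sym euv andbF.
  - by have := AB v u vA uB; rewrite e_sym euv andbF.
  - by rewrite /f uB vB !(negPf (notAB _ _)).
  - by have := WB v u vW uB; rewrite e_sym euv andbF.
  - by have := WA u v uW vA; rewrite euv andbF.
  - by have := WB u v uW vB; rewrite euv andbF.
  - by have := WW u v uW vW; rewrite euv.
have ge_comp : #|W| + 2 <= ncomp_del e S.
  apply: leq_trans (leq_ncomp_del e_sym fe).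
  have -> : #|W| + 2 = #|a |: (b |: W)|.
    have /andP[ab _] := AB a b aA bB.
    have aW : a \notin W by apply/negP => /notWA; rewrite aA.
    have bW : b \notin W by apply/negP => /notWB; rewrite bB.
    by rewrite !cardsU1 !inE (negPf ab) (negPf aW) bW /= addnC.
  apply/subset_leq_card/subsetP => v; rewrite !inE.
  have inS w : w \in A :|: B :|: W -> w \in ~: S by rewrite setCK.
  case/or3P => [/eqP->|/eqP->|vW]; apply/imsetP.
  - by exists a; rewrite /f ?aA // inS // !inE aA.
  - by exists b; rewrite /f ?bB ?(negPf (notAB b bB)) // inS // !inE bB orbT.
  - exists v; last by rewrite /f (negPf (notWA v vW)) (negPf (notWB v vW)).
    by rewrite inS // !inE vW orbT.
apply: le_trans (e_tough S _); last by apply: leq_trans ge_comp; rewrite addn2.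
by apply: ler_wpM2l => //; rewrite ler_nat.
Qed.

(** * From the vertices of a Hamiltonian path to positions [0 .. m] *)

Section HamiltonianPath.
Variables (T : finType) (e : rel T) (t : rat) (x : T) (p : seq T).
Hypothesis e_sym : symmetric e.
Hypothesis e_irr : irreflexive e.
Hypothesis t_ge4 : (4%:R <= t)%R.
Hypothesis n_ge3 : 3 <= #|T|.
Hypothesis e_tough : tough t e.
Hypothesis p_path : path e x p.
Hypothesis p_uniq : uniq (x :: p).
Hypothesis p_all : forall v, v \in x :: p.
Hypothesis deg_ends : (#|T|%:R - t <= (deg e x)%:R + (deg e (last x p))%:R)%R.

Let m := size p.
Let v i := nth x (x :: p) i.
Let E i j := e (v i) (v j).

Let size_s : size (x :: p) = m.+1. Proof. by []. Qed.

Let cardT_s : #|T| = m.+1.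
Proof. by rewrite -size_s -(card_uniqP p_uniq); apply: eq_card => u; rewrite p_all. Qed.

Let index_le u : index u (x :: p) <= m.
Proof. by rewrite -ltnS -size_s index_mem. Qed.

Let v_index u : v (index u (x :: p)) = u.
Proof. by rewrite /v nth_index. Qed.

Let card_cnt (P : pred nat) : #|[set u | P (index u (x :: p))]| = cnt m P.
Proof.
have -> : #|[set u | P (index u (x :: p))]| = count (fun u => P (index u (x :: p))) (x :: p).
  rewrite -size_filter -(card_uniqP (filter_uniq _ p_uniq)); apply: eq_card => u.
  by rewrite inE mem_filter p_all andbT.
rewrite /cnt -lock -(count_map (fun u => index u (x :: p)) P); congr count.
apply: (@eq_from_nth _ 0); rewrite size_map ?size_iota // => i im.
by rewrite (nth_map x) // index_uniq // nth_iota.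
Qed.

Let deg_cnt i : i <= m -> deg e (v i) = cnt m (E i).
Proof.
by move=> im; rewrite -card_cnt; apply: eq_card => u; rewrite !inE /E v_index.
Qed.

Let noham_cycle : ~~ [exists c : #|T|.-tuple T, ucycleb e c] ->
  forall c, perm_eq c (iota 0 m.+1) -> ~ cycle E c.
Proof.
move=> /existsPn nham c cE cc.
have csz : size (map v c) == #|T| by rewrite size_map cardT_s (perm_size cE) size_iota.
apply/negP: (nham (Tuple csz)); rewrite negbK /ucycleb /=; apply/andP; split.
  by move: cc; rewrite /cycle; case: (c) => //= i c'; rewrite -map_rcons path_map.
rewrite map_inj_in_uniq; first by rewrite (perm_uniq cE) iota_uniq.
move=> i j; rewrite !(perm_mem cE) !mem_iota !add0n /= => im jm /eqP.
by rewrite /v nth_uniq // => /eqP.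
Qed.

Lemma hamiltonian_of_path : hamiltonian e.
Proof.
(* A repetition-free cycle of length |T| is Hamiltonian, and tuples of that length form a finite
   type, so the case split is decidable. *)
have [/existsP[c /andP[cc cu]]|nham] := boolP [exists c : #|T|.-tuple T, ucycleb e c].
  exists c; split; [by apply/andP | by rewrite size_tuple |].
  have /subset_cardP/(_ (subset_predT _)) ceq : #|c| = #|T|.
    by rewrite (card_uniqP cu) size_tuple.
  by move=> u; rewrite ceq.
exfalso; apply: (@no_hamiltonian_path m E t) => //.
- by move=> i j; apply: e_sym.
- by move=> i; apply: e_irr.
- by move=> j jm; apply: (pathP x p_path).
- exact: noham_cycle.
- by move: n_ge3; rewrite cardT_s; case: (m).
- move=> A B W [a am Aa] [b bm Bb] AB WA WB WW.
  pose V (P : pred nat) := [set u | P (index u (x :: p))].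
  have ne (P : pred nat) i : i <= m -> P i -> V P != set0.
    move=> im Pi; apply/set0Pn; exists (v i); rewrite inE /v index_uniq //.
  have ap (P Q : pred nat) : apart m E P Q ->
      forall u w, u \in V P -> w \in V Q -> (u != w) && ~~ e u w.
    move=> PQ u w; rewrite !inE => Pu Qw.
    have /andP[] := PQ _ _ (index_le u) (index_le w) Pu Qw.
    rewrite /E !v_index => uw ->; rewrite andbT.
    by apply: contraNneq uw => ->.
  have t0 : (0 <= t)%R by apply: le_trans t_ge4.
  have := tough_separation e_sym t0 e_tough (ne _ _ am Aa) (ne _ _ bm Bb)
    (ap _ _ AB) (ap _ _ WA) (ap _ _ WB).
  have WW' u w : u \in V W -> w \in V W -> ~~ e u w.
    by rewrite !inE => Wu Ww; have := WW _ _ (index_le u) (index_le w) Wu Ww; rewrite /E !v_index.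
  move=> /(_ WW'); rewrite card_cnt => tgh.
  have ABu : [disjoint V A & V B].
    rewrite disjoints_subset; apply/subsetP => u uA; rewrite inE.
    by apply/negP => uB; have := ap _ _ AB u u uA uB; rewrite eqxx.
  have ABWu : [disjoint V A :|: V B & V W].
    rewrite disjoints_subset; apply/subsetP => u uAB; rewrite inE; apply/negP => uW.
    by case/setUP: uAB => u_in; [have := ap _ _ WA u u uW u_in | have := ap _ _ WB u u uW u_in];
      rewrite eqxx.
  have := cardsC (V A :|: V B :|: V W).
  rewrite cardsU (disjoint_setI0 ABWu) cards0 subn0 cardsU (disjoint_setI0 ABu) cards0 subn0.
  rewrite !card_cnt cardT_s => <-; rewrite [X in (_ <= X)%R]natrD addrC lerD2l.
  exact: tgh.
- move: deg_ends; rewrite -(deg_cnt (leq0n m)) -(deg_cnt (leqnn m)) cardT_s.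
  by rewrite /v -[last x p](nth_last x (x :: p)).
Qed.

End HamiltonianPath.

(** * Cutting a Hamiltonian cycle of G + xy open at the edge xy *)

Theorem theorem5 (t : rat) (T : finType) (e : rel T) (x y : T)
    (e_sym : symmetric e) (e_irr : irreflexive e)
    (t_ge4 : (4%:R <= t)%R)
    (n_ge3 : (3 <= #|T|)%N)
    (e_tough : tough t e)
    (x_neq_y : x != y) (xy_nonadj : ~~ e x y)
    (deg_xy : (#|T|%:R - t <= (deg e x)%:R + (deg e y)%:R)%R) :
  hamiltonian e <-> hamiltonian (add_edge e x y).
Proof.
split=> [[c [/andP[cc cu] c3 call]]|[c [/andP[cc cu] c3 call]]].
  exists c; split=> //; apply/andP; split=> //.
  by apply: sub_cycle cc => u v euv; rewrite /add_edge /= euv.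
(* With [x] in front, the new edge can only be the first or the closing one. *)
have [i c' cE] := rot_to (call x).
have {cc} : cycle (add_edge e x y) (x :: c') by rewrite -cE rot_cycle.
have {cu} cu : uniq (x :: c') by rewrite -cE rot_uniq.
have {call} call v : v \in x :: c' by rewrite -cE mem_rot.
have {c3 cE} c3 : 3 <= size (x :: c') by rewrite -cE size_rot.
case: c' cu call c3 => [//|z q] cu call c3 /=; rewrite rcons_path => /and3P[xz zq qx].
have {}zq : path e z q.
  apply: (sub_in_path (P := predC1 x)) zq => [u v ux vx|].
    by rewrite /add_edge /= (negPf (ux : u != x)) (negPf (vx : v != x)) !andbF !orbF.
  by apply/allP => u uzq; apply: contraTneq cu => <-; rewrite /= uzq.
have exz : z != y -> e x z.
  by move: xz; rewrite /add_edge /= => + /negPf zy; rewrite zy (negPf x_neq_y) andbF !orbF.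
have eqx : last z q != y -> e (last z q) x.
  move: qx; rewrite /add_edge /= => + /negPf qy.
  by rewrite qy (negPf x_neq_y) !andbF !orbF.
have [zy|zy] := eqVneq z y.
  (* The cycle has at least three vertices, so its closing edge is not xy as well; without its first
     edge it is a path from [y] to [x]. *)
  have qy : last z q != y.
    move: cu c3; rewrite zy; case/lastP: q {zq qx eqx call} => [//|q w] /= cu _.
    rewrite last_rcons; apply: contraTneq cu => ->.
    by rewrite mem_rcons mem_head andbF.
  apply: (@hamiltonian_of_path T e t z (rcons q x)) => //.
  - by rewrite rcons_path zq eqx.
  - by move: cu; rewrite -(cat1s x) uniq_catC -cats1.
  - by move=> v; have := call v; rewrite !inE mem_rcons inE orbCA.
  - by rewrite last_rcons zy [X in (_ <= X)%R]addrC.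
have [qy|qy] := eqVneq (last z q) y.
  apply: (@hamiltonian_of_path T e t x (z :: q)) => //=; first by rewrite exz.
  by rewrite qy.
exists (x :: z :: q); split=> //; rewrite /ucycle cu andbT.
by rewrite /= rcons_path exz // zq eqx.
Qed.
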